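(* Let $T$ be a tiling of a closed oriented surface by quadrilateral tiles. For each vertex $v$ in $T$, choose a different point $P_v$ in the real/complex 3-space. For each edge $e$ in $T$ with endpoints $u,v$, choose a point $P_e$ on the line $(P_uP_v)$. Assume that all these points are distinct. For each quadrilateral tile in $T$ with sides $a,b,c,d$ (listed consecutively), consider the condition $$\text{the points } P_a,\ P_b,\ P_c,\ \text{and } P_d \text{ are coplanar.}$$ If this condition holds for all quadrilateral tiles in $T$ except one, then it holds for the remaining quadrilateral tile.
   Context: The real/complex 3-space is the 3-dimensional projective space over the real or complex numbers. $(XY)$ denotes the line through two distinct points $X,Y$. ''All these points'' refers to all the points $P_v$ (for the vertices $v$ of $T$) and $P_e$ (for the edges $e$ of $T$). A tiling of a closed oriented surface by quadrilateral tiles is a finite cell decomposition of the surface in which every 2-cell (tile) is a topological quadrilateral, i.e. a disk whose boundary walk consists of four edges and passes through four (marked) vertices. No coloring of the vertices is assumed, and different edges are allowed to have the same pair of endpoints.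
   Formalization: It is additionally assumed that, for every tile other than the remaining one, the points P_v at its four corners are not coplanar; without this the claim fails, since a tile with coplanar corners satisfies the condition automatically and imposes no constraint on the points P_e. *)

(* Defs.v *)
From HB Require Import structures.
From mathcomp Require Import all_boot all_order all_algebra all_fingroup.
From mathcomp Require Import reals complex.
Set Implicit Arguments.
Unset Strict Implicit.
Unset Printing Implicit Defensive.
Import GRing.Theory.
Local Open Scope ring_scope.

Inductive real_or_complex : fieldType -> Prop :=
| real_numbers (R : realType) : real_or_complex R
| complex_numbers (R : realType) : real_or_complex R[i].

(* Points of the projective space P^3(K) are the lines through the origin of
   K^4, and projective lines and planes are its subspaces of dimension 2
   and 3. *)
Section ProjectiveSpace.
Variable K : fieldType.

Definition point3 : Type := {U : {vspace 'rV[K]_4} | \dim U == 1%N}.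

(* The sum of X and Y is the line (XY) only if X <> Y; for X = Y it reduces to
   the point X. *)
Definition on_line (P X Y : point3) : Prop := (sval P <= sval X + sval Y)%VS.

Definition coplanar (A B C D : point3) : Prop :=
  exists2 H : {vspace 'rV[K]_4}, \dim H = 3%N
    & [/\ (sval A <= H)%VS, (sval B <= H)%VS,
          (sval C <= H)%VS & (sval D <= H)%VS].

End ProjectiveSpace.

Definition perm_cycle (X : finType) (s : {perm X}) : Type :=
  {c : {set X} | c \in porbits s}.

Lemma mem_porbits (X : finType) (s : {perm X}) (x : X) :
  porbit s x \in porbits s.
Proof. exact: imset_f. Qed.

Definition cycle_of (X : finType) (s : {perm X}) (x : X) : perm_cycle s :=
  exist _ (porbit s x) (mem_porbits s x).

(* A cell decomposition of a closed oriented surface, encoded as a combinatorial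
   map.  A dart is a side of a tile, directed so that the tile lies on its left;
   [next_dart] goes to the following side of the same tile, and [opp_dart] to
   the other side of the same edge, directed the opposite way.  The two sides of an edge
   may belong to the same tile, and tiles may have repeated vertices.
   The surface need not be connected. *)
Record quad_tiling := QuadTiling {
  dart : finType;
  opp_dart : {perm dart};
  next_dart : {perm dart};
  opp_dartK : involutive opp_dart;
  opp_dart_neq : forall d, opp_dart d != d;
  tile4 : forall d, #|porbit next_dart d| = 4%N
}.

Section Cells.
Variable T : quad_tiling.
Implicit Type d : dart T.

(* Products of permutations apply the left factor first: [rot d] is
   [next_dart (opp_dart d)], which has the same source as [d]. *)
Definition rot : {perm dart T} := (opp_dart T * next_dart T)%g.

Definition vertex : Type := perm_cycle rot.
Definition edge : Type := perm_cycle (opp_dart T).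
Definition tile : Type := perm_cycle (next_dart T).

Definition source d : vertex := cycle_of rot d.
Definition target d : vertex := source (opp_dart T d).
Definition edge_of d : edge := cycle_of (opp_dart T) d.
Definition tile_of d : tile := cycle_of (next_dart T) d.

Variable K : fieldType.

(* When the four corners of a tile lie in a plane, so do its sides, and the
   coplanarity of four points chosen on the sides is no constraint. *)
Definition coplanar_corners (Pv : vertex -> point3 K) d : Prop :=
  coplanar (Pv (source d)) (Pv (source (next_dart T d)))
    (Pv (source (next_dart T (next_dart T d))))
    (Pv (source (next_dart T (next_dart T (next_dart T d))))).

Definition coplanar_sides (Pe : edge -> point3 K) d : Prop :=
  coplanar (Pe (edge_of d)) (Pe (edge_of (next_dart T d)))
    (Pe (edge_of (next_dart T (next_dart T d))))
    (Pe (edge_of (next_dart T (next_dart T (next_dart T d))))).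

End Cells.

(* Main.v *)
Require Import Defs.
From mathcomp Require Import all_boot all_order all_algebra all_fingroup.
From mathcomp Require Import ring.

(** The theorem is a multiplicative form of Menelaus' theorem spread over a
    closed surface.  Choose a nonzero vector x_v on each P_v.  Since P_e lies on
    the line of the endpoints of e and differs from both, a vector on P_e is a
    combination of the two endpoint vectors with nonzero coefficients.  Assign
    to each dart d the coefficient A d of the vector at its source; the
    coefficient at its target is then A (opp_dart d) ([edge_weights]).

    For a tile with successive darts d_0, ..., d_3, the four vectors on its sides
    are obtained from those on its corners by a cyclic bidiagonal matrix, of
    determinant prod A d_i - prod A (opp_dart d_i) ([det_quad_sides]).
    Hence the sides are coplanar exactly when the product of the ratios
    A d / A (opp_dart d) around the tile is 1 or the corners are already coplanar
    ([coplanar_sidesE]).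

    The product of these ratios over all darts is 1, because opp_dart permutes
    the darts ([prod_ratio]).  The darts are partitioned into tiles, and the
    product is 1 around every tile other than t0, where the corners are not
    coplanar.  So it is also 1 around t0 ([prod_all_but_one_porbit]), which
    makes the sides of t0 coplanar whatever the position of its corners. *)

Set Implicit Arguments.
Unset Strict Implicit.
Unset Printing Implicit Defensive.
Import GRing.Theory.
Local Open Scope ring_scope.

Section Points.
Variable K : fieldType.
Implicit Types P X Y : point3 K.

Definition rep P : 'rV[K]_4 := vpick (sval P).

Lemma point3E P : sval P = <[rep P]>%VS.
Proof.
case: P => U dimU; rewrite /rep /=; apply/eqP; rewrite eq_sym eqEdim.
have U_neq0 : U != 0%VS by rewrite -dimv_eq0 (eqP dimU).
by rewrite -memvE memv_pick dim_vline vpick0 U_neq0 (eqP dimU).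
Qed.

Lemma point3_inj P X : rep P \in sval X -> P = X.
Proof.
move=> PX; apply: val_inj; apply/eqP; rewrite /= eqEdim.
by rewrite (eqP (svalP P)) (eqP (svalP X)) andbT point3E -memvE.
Qed.

Lemma on_lineP P X Y :
  on_line P X Y -> exists ab : K * K, rep P = ab.1 *: rep X + ab.2 *: rep Y.
Proof.
rewrite /on_line !point3E -memvE => /memv_addP[_ /vlineP[a ->]].
by move=> [_ /vlineP[b ->] ->]; exists (a, b).
Qed.

(** If the coefficients b and d differed, Y would be a multiple of X, so that
    the line (XY), and P with it, would reduce to the point X. *)
Lemma coord_unique P X Y a b c d :
    rep P = a *: rep X + b *: rep Y -> rep P = c *: rep X + d *: rep Y ->
  X <> P -> b = d.
Proof.
move=> Pab Pcd XP; apply/eqP; rewrite -subr_eq0; apply/negPn/negP => bd'.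
have dbY : (b - d) *: rep Y = (c - a) *: rep X.
  rewrite !scalerBl -[b *: rep Y](addKr (a *: rep X)) -Pab Pcd.
  by rewrite addrA addrK addrC.
have XY : rep Y \in sval X.
  rewrite point3E -[rep Y](scalerK bd') dbY.
  by rewrite !memvZ ?memv_line.
apply: XP; apply/esym/point3_inj; rewrite Pab memvD ?memvZ //.
by rewrite point3E memv_line.
Qed.

Lemma coord_neq0 P X Y a b :
  rep P = a *: rep X + b *: rep Y -> Y <> P -> a != 0.
Proof.
move=> Pab YP; apply/eqP => a0; apply/YP/esym/point3_inj.
by rewrite Pab a0 scale0r add0r memvZ // point3E memv_line.
Qed.

(** One direction takes for plane the kernel of a nonzero linear form vanishing
    on the four points, which exists because the matrix is singular.
    Conversely, if the matrix were invertible its rows would span the whole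
    space, hence not fit in a plane. *)
Lemma coplanarP (F : nat -> point3 K) :
  coplanar (F 0) (F 1) (F 2) (F 3)
    <-> \det (\matrix_(i < 4) rep (F i)) = 0.
Proof.
set M := \matrix_i _.
have rowM (i : 'I_4) : rep (F i) = row i M by rewrite rowK.
split.
  case=> H dimH [F0 F1 F2 F3]; apply/eqP/negPn/negP => detM.
  have MH (i : 'I_4) : row i M \in H.
    rewrite -rowM memvE -point3E.
    by case: i => [[|[|[|[|]]]]].
  have : (fullv <= H)%VS.
    apply/subvP => u _.
    have uM : M \in unitmx by rewrite unitmxE unitfE.
    rewrite -[u](mulmxKV uM) mulmx_sum_row memv_suml // => i _.
    exact: memvZ.
  by move/dimvS; rewrite dimH dimvf /dim /= .
rewrite -det_tr => /eqP/det0P[v v_neq0 vM].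
pose f := linfun (mulmxr v^T : 'rV[K]_4 -> 'rV[K]_1).
exists (lker f).
  (* The form is nonzero and its codomain has dimension 1. *)
  have dim_im : \dim (limg f) = 1%N.
    apply/eqP; rewrite eqn_leq lt0n dimv_eq0.
    rewrite (leq_trans (dimvS (subvf _))) ?dimvf //=.
    have [j vj] : exists j, v 0 j != 0 by apply/rV0Pn.
    apply: contra vj => /eqP im0.
    have := memv_img f (memvf (delta_mx 0 j)).
    rewrite im0 memv0 lfunE /= -rowE => /eqP/matrixP/(_ 0 0).
    by rewrite !mxE => ->.
  have := limg_ker_dim f fullv.
  by rewrite capfv dim_im dimvf addn1 => -[].
have ker i : (sval (F (nat_of_ord (i : 'I_4))) <= lker f)%VS.
  rewrite point3E -memvE memv_ker lfunE /= rowM -row_mul.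
  by rewrite -[M]trmxK -trmx_mul vM trmx0 row0.
by split; [exact: (ker 0) | exact: (ker 1) | exact: (ker 2%:R) | exact: (ker 3%:R)].
Qed.

(** The sign of the second product is that of the 4-cycle, an odd permutation:
    the identity and the full cycle are the only permutations contributing to
    the determinant of the bidiagonal matrix C below. *)
Lemma det_quad_sides (a b : nat -> K) (x : nat -> 'rV[K]_4) :
    x 4%N = x 0%N ->
  \det (\matrix_(i < 4) (a i *: x i + b i *: x i.+1))
    = (\prod_(i < 4) a i - \prod_(i < 4) b i) * \det (\matrix_(i < 4) x i).
Proof.
move=> x4.
pose C : 'M[K]_4 :=
  \matrix_(i < 4, j < 4)
    (a i * (i == j)%:R + b i * (nat_of_ord j == i.+1 %% 4)%N%:R).
have -> : \matrix_(i < 4) (a i *: x i + b i *: x i.+1)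
    = C *m \matrix_(i < 4) x i.
  apply/row_matrixP => i; rewrite rowK row_mul mulmx_sum_row.
  rewrite !big_ord_recl big_ord0 !rowK !mxE.
  case: i => [[|[|[|[|]]]]] //= _;
    by rewrite ?(mulr1, mulr0, addr0, add0r, scale0r) ?x4 // addrC.
rewrite det_mulmx; congr (_ * _).
rewrite !big_ord_recl !big_ord0 /=.
rewrite (expand_det_row _ ord0) !big_ord_recl big_ord0 /cofactor.
rewrite !(expand_det_row _ (ord0 : 'I_3)) !big_ord_recl !big_ord0 /cofactor.
rewrite !(expand_det_row _ (ord0 : 'I_2)) !big_ord_recl !big_ord0 /cofactor.
rewrite !det_mx11 !mxE /= /bump /=.
ring.
Qed.
End Points.

Lemma prod_porbit (K : comNzRingType) (X : finType) (s : {perm X}) (F : X -> K) x :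
  \prod_(y in porbit s x) F y = \prod_(i < #|porbit s x|) F (iter i s x).
Proof.
rewrite (eq_bigl _ _ (porbit_traject s x)) -big_uniq ?uniq_traject_porbit //=.
rewrite (big_nth x) size_traject big_mkord.
by apply: eq_bigr => i _; rewrite nth_traject.
Qed.

(** The cycles of s partition X, so the product over X is the product over the
    cycles of the products along each of them. *)
Lemma prod_all_but_one_porbit (K : fieldType) (X : finType) (s : {perm X})
    (F : X -> K) x :
    \prod_y F y = 1 ->
    (forall y, porbit s y != porbit s x -> \prod_(z in porbit s y) F z = 1) ->
  \prod_(y in porbit s x) F y = 1.
Proof.
move=> prodF prod_other.
have fiber y : \prod_(z | porbit s z == porbit s y) F z
    = \prod_(z in porbit s y) F z.
  by apply: eq_bigl => z; rewrite eq_porbit_mem.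
rewrite -[RHS]prodF [RHS](partition_big (porbit s) (mem (porbits s))) /=; last first.
  by move=> y _; apply: imset_f.
rewrite (bigD1 (porbit s x)) ?imset_f //= fiber [X in _ * X]big1 ?mulr1 //.
by move=> _ /andP[/imsetP[y _ ->]] /prod_other; rewrite fiber.
Qed.

Section Tiling.
Variable T : quad_tiling.
Implicit Type d : dart T.

(** The permutation rot sends opp_dart d to next_dart d, since opp_dart is an
    involution; so the two lie in one cycle of rot. *)
Lemma source_next d : source (next_dart T d) = target d.
Proof.
rewrite /target /source; apply: val_inj => /=; apply/eqP.
rewrite eq_porbit_mem.
suff -> : next_dart T d = Defs.rot T (opp_dart T d) by apply: (mem_porbit (Defs.rot T) 1%N).
by rewrite permM opp_dartK.
Qed.

Lemma edge_of_opp d : edge_of (opp_dart T d) = edge_of d.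
Proof.
rewrite /edge_of; apply: val_inj => /=; apply/eqP.
by rewrite eq_porbit_mem (mem_porbit (opp_dart T) 1%N).
Qed.

Lemma target_opp d : target (opp_dart T d) = source d.
Proof. by rewrite /target opp_dartK. Qed.

Variable K : fieldType.
Variables (Pv : vertex T -> point3 K) (Pe : edge T -> point3 K).
Hypothesis Pe_on_line : forall d,
  on_line (Pe (edge_of d)) (Pv (source d)) (Pv (target d)).
Hypothesis Pv_Pe_distinct : forall v e, Pv v <> Pe e.

(** A vector on P_e is chosen once per edge, so the two darts of e decompose the
    same vector; uniqueness of the coefficients then says that the one at the
    target of d is the one that the opposite dart has at its source. *)
Lemma edge_weights : exists A : dart T -> K, forall d, A d != 0 /\
  rep (Pe (edge_of d)) = A d *: rep (Pv (source d))
                         + A (opp_dart T d) *: rep (Pv (target d)).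
Proof.
have [AB AB_P] := fin_all_exists (fun d => on_lineP (Pe_on_line d)).
exists (fun d => (AB d).1) => d; split; first exact: coord_neq0 (AB_P d) _.
rewrite [LHS]AB_P; congr (_ + _ *: _).
apply: coord_unique (AB_P d) _ _ => //.
by rewrite -edge_of_opp AB_P target_opp addrC.
Qed.

Section Weights.
Variable A : dart T -> K.
Hypothesis A_neq0 : forall d, A d != 0.
Hypothesis PeE : forall d,
  rep (Pe (edge_of d)) = A d *: rep (Pv (source d))
                         + A (opp_dart T d) *: rep (Pv (target d)).

Let ratio d := A d / A (opp_dart T d).

(** The numerator and the denominator are the same product, reindexed along
    opp_dart. *)
Lemma prod_ratio : \prod_d ratio d = 1.
Proof.
rewrite prodf_div (reindex_inj (@perm_inj _ (opp_dart T))) divff //.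
by apply/prodf_neq0 => d _.
Qed.

(** The determinant of the side vectors factors as the difference of the two
    weight products times the determinant of the corner vectors; it vanishes
    exactly when one factor does, and dividing by the second product, which is
    nonzero, turns the first case into a condition on ratios. *)
Lemma coplanar_sidesE d :
  coplanar_sides Pe d <->
  \prod_(e in porbit (next_dart T) d) ratio e = 1 \/ coplanar_corners Pv d.
Proof.
pose D i := iter i (next_dart T) d.
have D4 : D 4 = d by rewrite -[RHS](iter_porbit (next_dart T)) tile4.
have sidesP : coplanar_sides Pe d <-> _ :=
  coplanarP (fun i => Pe (edge_of (D i))).
have cornersP : coplanar_corners Pv d <-> _ :=
  coplanarP (fun i => Pv (source (D i))).
rewrite {}sidesP {}cornersP.
pose x i := rep (Pv (source (D i))).
have -> : \matrix_(i < 4) rep (Pe (edge_of (D i)))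
   = \matrix_(i < 4) (A (D i) *: x i + A (opp_dart T (D i)) *: x i.+1).
  by apply/row_matrixP => i; rewrite !rowK PeE -source_next.
rewrite (det_quad_sides (fun i => A (D i)) (fun i => A (opp_dart T (D i)))).
  2: by rewrite /x D4.
rewrite prod_porbit tile4 prodf_div.
set a := \prod_(i < 4) A _; set b := \prod_(i < 4) _.
have b_neq0 : b != 0 by apply/prodf_neq0 => i _.
rewrite -/x; split=> [/eqP|].
  rewrite mulf_eq0 subr_eq0 => /orP[/eqP ->|/eqP ?]; last by right.
  by left; rewrite divff.
case=> [/(canRL (divfK b_neq0))|->]; last by rewrite mulr0.
by rewrite mul1r => ->; rewrite subrr mul0r.
Qed.

End Weights.
End Tiling.

Theorem corollary8p10 (K : fieldType) (K_real_or_complex : real_or_complex K)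
    (T : quad_tiling)
    (Pv : vertex T -> point3 K) (Pe : edge T -> point3 K)
    (Pe_on_line : forall d : dart T,
       on_line (Pe (edge_of d)) (Pv (source d)) (Pv (target d)))
    (Pv_distinct : forall u v : vertex T, u <> v -> Pv u <> Pv v)
    (Pe_distinct : forall e f : edge T, e <> f -> Pe e <> Pe f)
    (Pv_Pe_distinct : forall (v : vertex T) (e : edge T), Pv v <> Pe e)
    (t0 : tile T)
    (nondegenerate : forall d : dart T,
       tile_of d <> t0 -> ~ coplanar_corners Pv d)
    (all_but_t0 : forall d : dart T, tile_of d <> t0 -> coplanar_sides Pe d) :
  forall d : dart T, tile_of d = t0 -> coplanar_sides Pe d.
Proof.
move=> d d_t0; have [A A_P] := edge_weights Pe_on_line Pv_Pe_distinct.
have A_neq0 e : A e != 0 by case: (A_P e).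
have sidesE := coplanar_sidesE A_neq0 (fun e => proj2 (A_P e)).
apply/sidesE; left; apply: prod_all_but_one_porbit (prod_ratio A_neq0) _.
move=> e ed; have e_t0 : tile_of e <> t0.
  by rewrite -d_t0 => /(congr1 sval) /= de; rewrite de eqxx in ed.
by case/sidesE: (all_but_t0 e e_t0) => // /(nondegenerate e e_t0).
Qed.
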